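(* For every integer $k\ge3$, $$\sum_{n=0}^{\infty}RD_3^{3,27}\left(3^kn+\frac{3^k+13}{2}\right)q^n\equiv0\pmod{3^{k+1}},$$ i.e. $RD_3^{3,27}\left(3^kn+\frac{3^k+13}{2}\right)\equiv0\pmod{3^{k+1}}$ for all integers $k\ge3$ and $n\ge0$.
   Context: For $r\ge1$, $E_r=\prod_{n=1}^{\infty}(1-q^{nr})$, $|q|<1$ (or as a formal power series in $q$). For positive integers $\ell,t,k$, $RD_k^{\ell,t}(n)$ denotes the number of partitions of $n$ in which each part carries one of $k$ colors, no part is divisible by $\ell$, and each colored part appears fewer than $t$ times; its generating function is $$\sum_{n=0}^{\infty}RD_k^{\ell,t}(n)q^n=\left(\frac{E_\ell E_t}{E_1E_{\ell t}}\right)^k.$$ In particular $\sum_{n\ge0}RD_3^{3,27}(n)q^n=\left(\frac{E_3E_{27}}{E_1E_{81}}\right)^3$. A congruence between power series means congruence of all coefficients. *)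

(* Defs.v *)
From mathcomp Require Import all_boot.
Set Implicit Arguments.
Unset Strict Implicit.
Unset Printing Implicit Defensive.

(* A partition of n with parts in k colours is a multiset of pairs
   (part, colour).  It is encoded by its multiplicity function: m (i, c) is the
   number of occurrences of the part i.+1 in colour c.  Parts are at most n and
   multiplicities are at most n, so the finite index and value types lose
   nothing. *)
Definition colored_partitions (k n : nat) : {set {ffun 'I_n * 'I_k -> 'I_n.+1}} :=
  [set m : {ffun 'I_n * 'I_k -> 'I_n.+1} |
     \sum_(p : 'I_n * 'I_k) m p * p.1.+1 == n].

(* The number RD_k^{l,t}(n). *)
Definition RD (k l t n : nat) : nat :=
  #|[set m in colored_partitions k n |
      [forall p : 'I_n * 'I_k, (0 < m p) ==> ~~ (l %| p.1.+1)]
      && [forall p : 'I_n * 'I_k, m p < t]]|.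

(* Main.v *)
Require Import Defs.
From HB Require Import structures.
From mathcomp Require Import all_boot all_algebra.
From mathcomp Require Import boolp.
From mathcomp Require Import ring zify.
Set Implicit Arguments.
Unset Strict Implicit.
Unset Printing Implicit Defensive.
Import GRing.Theory.

Local Open Scope ring_scope.

(** Write E_r for the product of the 1 - q^(rn) over n >= 1, and put rho = E_3/E_1 and
    tau = 27 q rho^12.  The generating series of RD_3^{3,27} is (rho(q)/rho(q^27))^3,
    and the coefficients along 3n + r of a series are one of its three sections modulo
    3, an operation that is linear over series in q^3.  So it suffices to dissect
    powers of rho^3.

    Jacobi's formula for E_1^3 has exponents j(j+1)/2, which are never 2 modulo 3, and
    are 1 modulo 3 only when j = 3i+1; hence E_1^3 = P(q^3) - 3 q E_9^3 for some series
    P ([euler3_dissection]).  Multiplying the three conjugates of this equation under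
    q -> zeta q, with zeta a cube root of unity, gives P^3 = E_1^12/E_3^3 + 27 q E_3^9.
    After normalization P becomes a cube root c of 1 + tau ([cbrt_cube]), and
    with w = 3 q rho(q^3)^4 and g = c(q^3) the two equations say ([rho_cube])

      rho^3 = rho(q^3) (g^2 + w g + w^2),  w^3 = tau(q^3),  g^3 = 1 + tau(q^3).

    Consequently rho^(3m) a, for a in Z[tau], is rho(q^3)^m times a combination over
    Z[tau(q^3)] of monomials in w and g whose total degree is 2m modulo 3.  Since g is
    a series in q^3 while w is 3 q times such a series, the section r = 2m mod 3 keeps
    only the monomials w^r times a power of g^3: it lies in Z[tau] up to a power of rho,
    and it has picked up the factor 3^r.

    The progression 27n + 20 is reached by the sections 2, 0, 2, which produce
    rho^9, rho^3 and rho^6 in turn and contribute 9 * 1 * 9 = 3^4.  Each increase of k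
    by one is a section 1, which maps rho^6 Z[tau] into 3 rho^6 Z[tau]
    ([sec1_step]). *)

(** * Formal power series over the integers *)

Record series := Series { coef : nat -> int }.

Lemma seriesP (f g : series) : coef f =1 coef g -> f = g.
Proof. by case: f g => [a] [b] /= /funext ->. Qed.

HB.instance Definition _ := gen_eqMixin series.
HB.instance Definition _ := gen_choiceMixin series.

Definition szero := Series (fun _ => 0).
Definition sadd f g := Series (fun n => coef f n + coef g n).
Definition sopp f := Series (fun n => - coef f n).

Fact saddA : associative sadd.
Proof. by move=> f g h; apply: seriesP => n; rewrite /= addrA. Qed.
Fact saddC : commutative sadd.
Proof. by move=> f g; apply: seriesP => n; rewrite /= addrC. Qed.
Fact sadd0 : left_id szero sadd.
Proof. by move=> f; apply: seriesP => n; rewrite /= add0r. Qed.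
Fact saddN : left_inverse szero sopp sadd.
Proof. by move=> f; apply: seriesP => n; rewrite /= addNr. Qed.

HB.instance Definition _ := GRing.isZmodule.Build series saddA saddC sadd0 saddN.

Definition sone := Series (fun n => (n == 0)%:R).
Definition smul f g :=
  Series (fun n => \sum_(i < n.+1) coef f i * coef g (n - i)).

(** Ring laws and congruences are transported from polynomials: the coefficients up to
    order n of a product are those of the product of the truncations. *)
Definition trunc n f : {poly int} := \poly_(i < n.+1) coef f i.

Lemma coef_trunc n f k : (k <= n)%N -> (trunc n f)`_k = coef f k.
Proof. by move=> kn; rewrite coef_poly ltnS kn. Qed.

Lemma coef_smul_trunc n f g k : (k <= n)%N ->
  coef (smul f g) k = (trunc n f * trunc n g)`_k.
Proof.
move=> kn; rewrite coefM; apply: eq_bigr => i _.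
by have ltik := ltn_ord i; rewrite !coef_trunc //; lia.
Qed.

Lemma eq_coefM (p p' r r' : {poly int}) n :
    (forall k, (k <= n)%N -> p`_k = p'`_k) ->
    (forall k, (k <= n)%N -> r`_k = r'`_k) ->
  (p * r)`_n = (p' * r')`_n.
Proof.
move=> hp hr; rewrite !coefM; apply: eq_bigr => i _.
by have ltik := ltn_ord i; rewrite hp ?hr //; lia.
Qed.

Fact smulA : associative smul.
Proof.
move=> f g h; apply: seriesP => n; rewrite !(coef_smul_trunc _ _ (leqnn n)).
transitivity ((trunc n f * (trunc n g * trunc n h))`_n); last rewrite mulrA.
  by apply: eq_coefM => k kn //; rewrite coef_trunc // (coef_smul_trunc _ _ kn).
by apply: eq_coefM => k kn //; rewrite coef_trunc // (coef_smul_trunc _ _ kn).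
Qed.
Fact smulC : commutative smul.
Proof.
by move=> f g; apply: seriesP => n; rewrite !(coef_smul_trunc _ _ (leqnn n)) mulrC.
Qed.
Fact smul1 : left_id sone smul.
Proof.
move=> f; apply: seriesP => n /=; rewrite big_ord_recl /= mul1r subn0.
by rewrite big1 ?addr0 // => i _; rewrite mul0r.
Qed.
Fact smulDl : left_distributive smul sadd.
Proof.
move=> f g h; apply: seriesP => n /=; rewrite -big_split.
by apply: eq_bigr => i _; rewrite mulrDl.
Qed.
Fact sone_neq0 : sone != 0 :> series.
Proof. by apply/eqP => /(congr1 (fun f => coef f 0)). Qed.

HB.instance Definition _ :=
  GRing.Zmodule_isComNzRing.Build series smulA smulC smul1 smulDl sone_neq0.

Lemma coef1 n : coef 1 n = (n == 0)%:R. Proof. by []. Qed.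
Lemma coefD f g n : coef (f + g) n = coef f n + coef g n. Proof. by []. Qed.
Lemma coefM f g n : coef (f * g) n = \sum_(i < n.+1) coef f i * coef g (n - i).
Proof. by []. Qed.
Lemma coefB f g n : coef (f - g) n = coef f n - coef g n. Proof. by []. Qed.

Lemma coefMn f m n : coef (f *+ m) n = coef f n *+ m.
Proof. by elim: m => // m IH; rewrite !mulrS coefD IH. Qed.

Lemma coef_sum I (r : seq I) (P : pred I) (F : I -> series) n :
  coef (\sum_(i <- r | P i) F i) n = \sum_(i <- r | P i) coef (F i) n.
Proof. by elim/big_rec2: _ => // i x y _ <-. Qed.

Definition q := Series (fun n => (n == 1)%:R).

Lemma coef_qM f n : coef (q * f) n = if n is m.+1 then coef f m else 0.
Proof.
rewrite coefM; case: n => [|n]; first by rewrite big_ord1 mul0r.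
rewrite 2!big_ord_recl /= mul0r mul1r add0r subn1 /= big1 ?addr0 // => i _.
by rewrite mul0r.
Qed.

Lemma coef_qXnM f m n :
  coef (q ^+ m * f) n = if (m <= n)%N then coef f (n - m) else 0.
Proof.
elim: m n => [|m IH] n; first by rewrite mul1r subn0.
by rewrite exprS -mulrA coef_qM; case: n => // n; rewrite IH ltnS subSS.
Qed.

Lemma coef_qXn m n : coef (q ^+ m) n = (n == m)%:R.
Proof.
by rewrite -[q ^+ m]mulr1 coef_qXnM coef1; case: leqP => mn; [congr (_%:R)|]; lia.
Qed.

(** Congruence modulo q^(m+1).  Being an equality of truncations, it is an equivalence
    relation by the laws of equality. *)
Definition eqmodq m (f g : series) := trunc m f = trunc m g.

Notation "f =_[ m ] g" := (eqmodq m f g) (at level 70, m at level 2).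

Lemma eqmodqP m f g :
  f =_[m] g <-> forall k, (k <= m)%N -> coef f k = coef g k.
Proof.
split=> [h k km | h]; first by rewrite -(coef_trunc f km) h coef_trunc.
by apply/polyP => k; rewrite !coef_poly ltnS; case: leqP => // /h.
Qed.

Lemma eqmodq_trans m g f h : f =_[m] g -> g =_[m] h -> f =_[m] h.
Proof. exact: etrans. Qed.

Lemma eqmodq_le m n f g : (m <= n)%N -> f =_[n] g -> f =_[m] g.
Proof. by move=> mn /eqmodqP h; apply/eqmodqP => k km; apply: h; lia. Qed.

Lemma eqmodqD m f f' g g' : f =_[m] f' -> g =_[m] g' -> f + g =_[m] f' + g'.
Proof.
move=> /eqmodqP h1 /eqmodqP h2; apply/eqmodqP => k km.
by rewrite !coefD h1 ?h2.
Qed.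

Lemma eqmodqM m f f' g g' : f =_[m] f' -> g =_[m] g' -> f * g =_[m] f' * g'.
Proof.
move=> /eqmodqP h1 /eqmodqP h2; apply/eqmodqP => k km.
rewrite !coefM; apply: eq_bigr => i _.
by have ltik := ltn_ord i; rewrite h1 ?h2 //; lia.
Qed.

Lemma eqmodqX m n f g : f =_[m] g -> f ^+ n =_[m] g ^+ n.
Proof. by move=> h; elim: n => // n IH; rewrite !exprS; apply: eqmodqM. Qed.

Lemma eqmodq_sum m I (r : seq I) (P : pred I) (F G : I -> series) :
    (forall i, P i -> F i =_[m] G i) ->
  \sum_(i <- r | P i) F i =_[m] \sum_(i <- r | P i) G i.
Proof.
by move=> h; elim/big_rec2: _ => // i x y Pi; apply: eqmodqD; apply: h.
Qed.

Lemma eqmodq_prod m I (r : seq I) (P : pred I) (F G : I -> series) :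
    (forall i, P i -> F i =_[m] G i) ->
  \prod_(i <- r | P i) F i =_[m] \prod_(i <- r | P i) G i.
Proof.
by move=> h; elim/big_rec2: _ => // i x y Pi; apply: eqmodqM; apply: h.
Qed.

Lemma eqmodq_qXn m n f : (m < n)%N -> q ^+ n * f =_[m] 0.
Proof.
move=> mn; apply/eqmodqP => k km.
by rewrite coef_qXnM leqNgt (leq_ltn_trans km mn).
Qed.

Lemma eqmodq_eq f g : (forall m, f =_[m] g) -> f = g.
Proof. by move=> h; apply: seriesP => n; have /eqmodqP := h n; apply. Qed.

(** The limit of a sequence whose n-th term is already correct up to order n; see
    [eqmodq_slim]. *)
Definition slim (F : nat -> series) := Series (fun n => coef (F n) n).

Lemma eqmodq_slim F m : (forall n, F n.+1 =_[n] F n) -> slim F =_[m] F m.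
Proof.
move=> h; apply/eqmodqP => k /=; elim: m => [|m IH]; first by case: k.
rewrite leq_eqVlt => /orP[/eqP -> // | km].
by move/eqmodqP: (h m) => -> //; apply: IH.
Qed.

(** The geometric series in 1 - f. *)
Definition sinv f := slim (fun n => \sum_(k < n.+1) (1 - f) ^+ k).

Lemma mul_sinv f : coef f 0 = 1 -> f * sinv f = 1.
Proof.
move=> f0; rewrite /sinv; set F := (F in slim F).
have [h fE] : exists h, f = 1 - q * h.
  exists (Series (fun n => - coef f n.+1)); apply: seriesP => n.
  rewrite coefB coef_qM coef1.
  by case: n => [|n] /=; rewrite ?f0 ?subr0 // sub0r opprK.
have small n : (1 - f) ^+ n.+1 =_[n] 0.
  by rewrite fE opprB addrCA subrr addr0 exprMn; apply: eqmodq_qXn.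
have FC n : F n.+1 =_[n] F n.
  by rewrite /F big_ord_recr /= -[X in _ =_[_] X]addr0; apply: eqmodqD.
apply: eqmodq_eq => m.
apply: (eqmodq_trans (g := f * F m)); first by apply: eqmodqM (eqmodq_slim _ _).
have -> : f * F m = 1 + (- 1) * (1 - f) ^+ m.+1.
  rewrite mulN1r -[X in X - _](expr1n _ m.+1) subrXX; congr (_ * _); first by ring.
  by apply: eq_bigr => i _; rewrite expr1n mul1r.
rewrite -[X in _ =_[_] X]addr0 -[X in _ =_[_] _ + X](mulr0 (-1)).
by apply: eqmodqD => //; apply: eqmodqM.
Qed.

(** * Dissection modulo 3 *)

(** [dil f] is f(q^3), and f is the sum of the q^r (sec r f)(q^3) for r < 3.  These are
    the operators usually written V_3 and U_3. *)
Definition dil f := Series (fun n => if (3 %| n)%N then coef f (n %/ 3) else 0).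
Definition sec r f := Series (fun n => coef f (3 * n + r)).

Lemma coef_dil_trunc n f k : (k <= n)%N ->
  coef (dil f) k = (trunc n f \Po 'X^3)`_k.
Proof.
move=> kn; rewrite coef_comp_poly_Xn //=; case: ifP => // k3.
by rewrite coef_trunc // (leq_trans (leq_div _ _)).
Qed.

Fact dil_is_additive : zmod_morphism dil.
Proof.
move=> f g; apply: seriesP => n; rewrite coefB /=.
by case: ifP => _; rewrite ?subr0 // coefB.
Qed.

Fact dil_is_multiplicative : monoid_morphism dil.
Proof.
split; first by apply: seriesP => n /=; case: ifP => n3; [congr (_%:R)|]; lia.
move=> f g; apply: seriesP => n; rewrite (coef_dil_trunc _ (leqnn n)).
have -> : coef (dil f * dil g) n
        = ((trunc n f * trunc n g) \Po 'X^3)`_n.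
  rewrite comp_polyM coefM poly.coefM; apply: eq_bigr => i _.
  by have lti := ltn_ord i; rewrite -!coef_dil_trunc //; lia.
rewrite !coef_comp_poly_Xn //; case: ifP => // _.
by rewrite -coef_smul_trunc ?coef_trunc // leq_div.
Qed.

HB.instance Definition _ :=
  GRing.isZmodMorphism.Build series series dil dil_is_additive.
HB.instance Definition _ :=
  GRing.isMonoidMorphism.Build series series dil dil_is_multiplicative.

Lemma dil_q : dil q = q ^+ 3.
Proof.
apply: seriesP => n; rewrite coef_qXn /=.
by case: ifP => n3; [congr (_%:R)|]; lia.
Qed.

Lemma eqmodq_dil m f g : f =_[m] g -> dil f =_[m] dil g.
Proof.
move=> /eqmodqP h; apply/eqmodqP => k km /=.
by case: ifP => // _; apply: h; apply: leq_trans (leq_div _ _) km.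
Qed.

Lemma eqmodq_sec r m f g : (r < 3)%N -> f =_[3 * m + 2] g -> sec r f =_[m] sec r g.
Proof. by move=> r3 /eqmodqP h; apply/eqmodqP => k km /=; apply: h; lia. Qed.

Lemma coef_dissection a b c n (f := dil a + q * dil b + q ^+ 2 * dil c) :
  [/\ coef f (3 * n) = coef a n, coef f (3 * n + 1) = coef b n
    & coef f (3 * n + 2) = coef c n].
Proof.
rewrite /f !coefD -[q * dil b]/(q ^+ 1 * dil b) !coef_qXnM /=.
have h k (x : nat) : (k <= 3 * n + x)%N -> (x < 3)%N -> (k < 3)%N ->
   forall z : series,
     (if (3 %| 3 * n + x - k)%N then coef z ((3 * n + x - k) %/ 3) else 0)
     = if x == k then coef z n else 0.
  move=> h1 h2 h3 z; case: ifP => d3; case: eqP => e //; try lia.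
  by congr (coef z _); lia.
by split; do ![case: ifP => ?]; rewrite ?add0r ?addr0 //; try lia;
  do ?[congr coef]; try lia.
Qed.

Lemma dissection f : f = dil (sec 0 f) + q * dil (sec 1 f) + q ^+ 2 * dil (sec 2 f).
Proof.
apply: seriesP => n.
have [h0 h1 h2] := coef_dissection (sec 0 f) (sec 1 f) (sec 2 f) (n %/ 3).
have := divn_eq n 3; have : (n %% 3 < 3)%N by rewrite ltn_mod.
rewrite mulnC; case: (n %% 3)%N => [|[|[|//]]] _ -> ;
  rewrite ?addn0 ?h0 ?h1 ?h2 /= ?addn0 //.
Qed.

Lemma sec_dissection a b c (f := dil a + q * dil b + q ^+ 2 * dil c) :
  [/\ sec 0 f = a, sec 1 f = b & sec 2 f = c].
Proof.
by split; apply: seriesP => n; have [h0 h1 h2] := coef_dissection a b c n;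
  rewrite /= ?addn0.
Qed.

Lemma secM f g :
  [/\ sec 0 (f * g) = sec 0 f * sec 0 g + q * (sec 1 f * sec 2 g + sec 2 f * sec 1 g),
      sec 1 (f * g) = sec 0 f * sec 1 g + sec 1 f * sec 0 g + q * (sec 2 f * sec 2 g)
    & sec 2 (f * g) = sec 0 f * sec 2 g + sec 1 f * sec 1 g + sec 2 f * sec 0 g].
Proof.
set a := (X in sec 0 _ = X); set b := (X in sec 1 _ = X); set c := (X in sec 2 _ = X).
suff -> : f * g = dil a + q * dil b + q ^+ 2 * dil c by apply: sec_dissection.
rewrite {1}(dissection f) {1}(dissection g) /a /b /c !(rmorphD, rmorphM) /= dil_q.
ring.
Qed.

(** The product of f(q), f(zeta q) and f(zeta^2 q), for zeta a primitive cube root of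
    unity, is a series in q^3; [norm3 f] is that series with q^3 replaced by q.  It is
    the determinant of multiplication by f over the series in q^3, written in terms of
    sections so that no root of unity is involved. *)
Definition norm3 f :=
  sec 0 f ^+ 3 + q * sec 1 f ^+ 3 + q ^+ 2 * sec 2 f ^+ 3
  - 3%:R * q * sec 0 f * sec 1 f * sec 2 f.

Lemma norm3M f g : norm3 (f * g) = norm3 f * norm3 g.
Proof. by rewrite /norm3; have [-> -> ->] := secM f g; ring. Qed.

Lemma norm3E a b c :
  norm3 (dil a + q * dil b + q ^+ 2 * dil c)
  = a ^+ 3 + q * b ^+ 3 + q ^+ 2 * c ^+ 3 - 3%:R * q * a * b * c.
Proof. by rewrite /norm3; have [-> -> ->] := sec_dissection a b c. Qed.

Lemma norm3_dil a : norm3 (dil a) = a ^+ 3.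
Proof.
have -> : dil a = dil a + q * dil 0 + q ^+ 2 * dil 0 by rewrite !rmorph0; ring.
by rewrite norm3E; ring.
Qed.

Lemma norm3X f n : norm3 (f ^+ n) = norm3 f ^+ n.
Proof.
elim: n => [|n IH]; last by rewrite !exprS norm3M IH.
by rewrite expr0 -(rmorph1 dil) norm3_dil expr1n.
Qed.

Lemma eqmodq_norm3 m f g : f =_[3 * m + 2] g -> norm3 f =_[m] norm3 g.
Proof.
move=> h; rewrite /norm3 -!mulNr.
by do ![apply: eqmodqD || apply: eqmodqM || apply: eqmodqX || apply: eqmodq_sec].
Qed.

(** * Euler's product *)

Definition qpoch n := \prod_(i < n) (1 - q ^+ i.+1).
Definition euler := slim qpoch.

Lemma qpochS n : qpoch n.+1 = qpoch n * (1 - q ^+ n.+1).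
Proof. exact: big_ord_recr. Qed.

Lemma eqmodq_qpochS n : qpoch n.+1 =_[n] qpoch n.
Proof.
rewrite qpochS -[X in _ =_[_] X]addr0 mulrBr mulr1; apply: eqmodqD => //.
by rewrite mulrC -mulNr -mulrN1 -mulrA; apply: eqmodq_qXn.
Qed.

Lemma eqmodq_qpoch m n : (m <= n)%N -> qpoch n =_[m] euler.
Proof.
move=> mn; apply: (eqmodq_le mn); apply/esym/eqmodq_slim; exact: eqmodq_qpochS.
Qed.

Lemma coef_euler0 : coef euler 0 = 1. Proof. by rewrite /= /qpoch big_ord0. Qed.

(** If 3 does not divide n, the conjugates of 1 - q^n multiply to 1 - q^(3n); if 3
    divides n they all coincide. *)
Lemma norm3_factor m :
  [/\ norm3 (1 - q ^+ (3 * m).+1) = 1 - q ^+ (3 * m).+1,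
      norm3 (1 - q ^+ (3 * m).+2) = 1 - q ^+ (3 * m).+2
    & norm3 (1 - q ^+ (3 * m).+3) = (1 - q ^+ m.+1) ^+ 3].
Proof.
split.
- have e : 1 - q ^+ (3 * m).+1 = dil 1 + q * dil (- q ^+ m) + q ^+ 2 * dil 0.
    by rewrite rmorph0 rmorph1 rmorphN rmorphXn /= dil_q -exprM exprS; ring.
  rewrite {1}e norm3E (_ : q ^+ (3 * m).+1 = q * (q ^+ m) ^+ 3); first by ring.
  by rewrite exprS -exprM mulnC.
- have e : 1 - q ^+ (3 * m).+2 = dil 1 + q * dil 0 + q ^+ 2 * dil (- q ^+ m).
    by rewrite rmorph0 rmorph1 rmorphN rmorphXn /= dil_q -exprM !exprS; ring.
  rewrite {1}e norm3E (_ : q ^+ (3 * m).+2 = q ^+ 2 * (q ^+ m) ^+ 3); first by ring.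
  by rewrite -exprM -exprD mulnC.
rewrite -norm3_dil rmorphB rmorph1 rmorphXn /= dil_q -exprM.
by congr (norm3 (_ - q ^+ _)); lia.
Qed.

Lemma prod_ord3 (F : nat -> series) m :
  \prod_(i < 3 * m) F i = \prod_(i < m) (F (3 * i)%N * F (3 * i).+1 * F (3 * i).+2).
Proof.
elim: m => [|m IH]; first by rewrite !big_ord0.
by rewrite mulnS addnC addn3 !big_ord_recr /= IH !mulrA.
Qed.

Lemma dil_qpoch m : dil (qpoch m) = \prod_(i < m) (1 - q ^+ (3 * i).+3).
Proof.
rewrite rmorph_prod; apply: eq_bigr => i _.
by rewrite rmorphB rmorph1 rmorphXn /= dil_q -exprM mulnS.
Qed.

(** With q^3 in place of q this is the identity
    E_1(q) E_1(zeta q) E_1(zeta^2 q) = E_3^4 / E_9. *)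
Lemma norm3_euler : norm3 euler * dil euler = euler ^+ 4.
Proof.
(* Truncating the product at a multiple of 3 keeps the three residue classes aligned. *)
apply: eqmodq_eq => m; pose M := m.+1.
have h n : (m <= n)%N -> euler =_[m] qpoch n by move=> mn; apply/esym/eqmodq_qpoch.
apply: (eqmodq_trans (g := norm3 (qpoch (3 * M)) * dil (qpoch M))).
  apply: eqmodqM; last by apply/eqmodq_dil/h/leqnSn.
  by apply: eqmodq_norm3; apply/esym/eqmodq_qpoch; rewrite /M; lia.
suff -> : norm3 (qpoch (3 * M)) * dil (qpoch M) = qpoch (3 * M) * qpoch M ^+ 3.
  rewrite (exprS euler 3); apply: esym; apply: eqmodqM.
    by apply: h; rewrite /M; lia.
  by apply: eqmodqX; apply: h.
have norm3_prod k (F : nat -> series) :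
    norm3 (\prod_(i < k) F i) = \prod_(i < k) norm3 (F i).
  elim: k => [|k IH].
    by rewrite !big_ord0 -(rmorph1 dil) norm3_dil expr1n rmorph1.
  by rewrite !big_ord_recr norm3M IH.
rewrite /qpoch (norm3_prod _ (fun i => 1 - q ^+ i.+1)).
rewrite (prod_ord3 (fun i => norm3 (1 - q ^+ i.+1))).
rewrite (prod_ord3 (fun i => 1 - q ^+ i.+1)).
rewrite -/(qpoch M) dil_qpoch /qpoch -prodrXl -!big_split; apply: eq_bigr => i _ /=.
have [-> -> ->] := norm3_factor i; ring.
Qed.

(** * Jacobi's formula for the cube of Euler's product *)

Fixpoint qbinom N k : series :=
  match N, k with
  | _, 0 => 1
  | 0, _.+1 => 0
  | N'.+1, k'.+1 => qbinom N' k' + q ^+ k'.+1 * qbinom N' k'.+1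
  end.

Lemma qbinom0 N : qbinom N 0 = 1. Proof. by case: N. Qed.

Lemma qbinomS N k :
  qbinom N.+1 k.+1 = qbinom N k + q ^+ k.+1 * qbinom N k.+1.
Proof. by []. Qed.

Lemma qbinom_small N k : (N < k)%N -> qbinom N k = 0.
Proof.
elim: N k => [|N IH] [|k] //= Nk.
by rewrite !IH ?mulr0 ?addr0 //; lia.
Qed.

Lemma qbinomnn N : qbinom N N = 1.
Proof. by elim: N => //= N ->; rewrite qbinom_small // mulr0 addr0. Qed.

Lemma qbinom_qpoch a b : qbinom (a + b) a * qpoch a * qpoch b = qpoch (a + b).
Proof.
have q0 : qpoch 0 = 1 by rewrite /qpoch big_ord0.
elim: a b => [|a IHa] b; first by rewrite qbinom0 q0 !mul1r.
elim: b => [|b IHb]; first by rewrite addn0 qbinomnn q0 mul1r mulr1.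
have ha := IHa b.+1; rewrite addnS in ha.
rewrite addSn addnS [in qbinom _ _]qbinomS mulrDl mulrDl.
rewrite [qpoch a.+1 in X in X + _]qpochS.
rewrite (_ : _ * _ * qpoch b.+1 = (1 - q ^+ a.+1) * qpoch (a + b).+1);
  last by rewrite -ha; ring.
rewrite (_ : _ * _ * qpoch b.+1 = q ^+ a.+1 * (1 - q ^+ b.+1) * qpoch (a + b).+1);
  last by rewrite -[(a + b).+1]addSn -IHb [qpoch b.+1]qpochS addSn; ring.
rewrite [RHS]qpochS (_ : (a + b).+2 = a.+1 + b.+1)%N ?exprD; last by lia.
ring.
Qed.

(** The homogeneous form in y and z makes it possible to evaluate at z/y = - q^(-n)
    without negative powers of q. *)
Lemma q_binomial_theorem N (y z : {poly series}) :
  \prod_(i < N) (y + q ^+ i *: z)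
  = \sum_(k < N.+1) (q ^+ 'C(k, 2) * qbinom N k) *: (y ^+ (N - k) * z ^+ k).
Proof.
(* Splitting off the factor i = 0 turns the others into the case N at q z. *)
elim: N z => [|N IH] z.
  by rewrite big_ord0 big_ord1 /= mulr1 expr0 scale1r mulr1.
rewrite big_ord_recl /= expr0 scale1r.
under eq_bigr => i _ do rewrite /bump add1n exprSr -scalerA.
rewrite (IH (q *: z)) mulrDl.
have -> : y * \sum_(k < N.+1)
      (q ^+ 'C(k, 2) * qbinom N k) *: (y ^+ (N - k) * (q *: z) ^+ k)
    = \sum_(k < N.+2) (q ^+ 'C(k, 2) * q ^+ k * qbinom N k)
         *: (y ^+ (N.+1 - k) * z ^+ k).
  rewrite [RHS]big_ord_recr /= qbinom_small // mulr0 scale0r addr0 mulr_sumr.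
  apply: eq_bigr => k _; have ltk := ltn_ord k.
  rewrite subSn; last by rewrite -ltnS.
  by rewrite exprZn -!mul_polyC exprS !polyCM; ring.
have -> : z * \sum_(k < N.+1)
      (q ^+ 'C(k, 2) * qbinom N k) *: (y ^+ (N - k) * (q *: z) ^+ k)
    = \sum_(k < N.+1) (q ^+ 'C(k.+1, 2) * qbinom N k)
         *: (y ^+ (N.+1 - k.+1) * z ^+ k.+1).
  rewrite mulr_sumr; apply: eq_bigr => k _.
  rewrite subSS exprZn binS bin1 exprD -!mul_polyC exprS !polyCM; ring.
rewrite big_ord_recl [RHS]big_ord_recl /= !qbinom0 !mulr1 -addrA; congr (_ + _).
rewrite -big_split; apply: eq_bigr => k _ /=.
by rewrite -scalerDl /bump add1n; congr (_ *: _); ring.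
Qed.

Lemma q_reg n f g : q ^+ n * f = q ^+ n * g -> f = g.
Proof.
move=> h; apply: seriesP => k; have := congr1 (fun f => coef f (n + k)) h.
by rewrite !coef_qXnM leq_addr addKn.
Qed.

Lemma binS2 j : 'C(j.+1, 2) = ('C(j, 2) + j)%N.
Proof. by rewrite binS bin1. Qed.

Lemma prod_qsub n :
  \prod_(i < n) (q ^+ n - q ^+ i) = (-1) ^+ n * q ^+ 'C(n, 2) * qpoch n.
Proof.
have -> : qpoch n = \prod_(i < n) (1 - q ^+ (n - i)).
  rewrite /qpoch (reindex_inj rev_ord_inj) /=; apply: eq_bigr => i _.
  by have lti := ltn_ord i; rewrite subnSK.
have -> : (-1) ^+ n * q ^+ 'C(n, 2) = \prod_(i < n) (- q ^+ i).
  elim: n => [|n IH]; first by rewrite big_ord0 mulr1.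
  by rewrite big_ord_recr -IH binS2 exprD exprS /=; ring.
rewrite -big_split; apply: eq_bigr => i _ /=; have lti := ltn_ord i.
by rewrite -{1}(subnKC (ltnW lti)) exprD; ring.
Qed.

(** The derivative at X = 1 of the q-binomial theorem for the product of the
    q^n - q^i X over i <= 2n.  The factor i = n vanishes at 1, so on the product side
    only its derivative - q^n contributes, multiplied by the other factors at 1. *)
Lemma q_binomial_derivative n (N := (n + n.+1)%N) :
  \sum_(k < N.+1) (-1) ^+ k * k%:R * q ^+ ('C(k, 2) + n * (N - k)) * qbinom N k
  = - (-1) ^+ n * q ^+ (n + 'C(n, 2) + n * n) * qpoch n ^+ 2.
Proof.
have := q_binomial_theorem N (q ^+ n)%:P (- 'X).
move/(congr1 (fun p => p^`().[1])).
rewrite raddf_sum horner_sum => h; transitivity (\sum_(i < N.+1)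
  ((q ^+ 'C(i, 2) * qbinom N i)
       *: ((q ^+ n)%:P ^+ (N - i) * (- 'X) ^+ i))^`().[1]).
  apply: eq_bigr => k _; set c := _ * qbinom N k.
  have -> : c *: ((q ^+ n)%:P ^+ (N - k) * (- 'X) ^+ k)
     = (c * (q ^+ n) ^+ (N - k) * (-1) ^+ k) *: 'X^k.
    by rewrite (exprNn 'X) -!mul_polyC !(rmorphM, rmorphXn, rmorphN1) /=; ring.
  by rewrite derivZ derivXn hornerZ hornerMn hornerXn expr1n -exprM exprD /c; ring.
rewrite -h {h} big_split_ord big_ord_recl /= addn0.
set A := \prod_(i < n) _; set B := \prod_(i < n) _.
have hA : A.[1] = (-1) ^+ n * q ^+ 'C(n, 2) * qpoch n.
  rewrite -prod_qsub horner_prod; apply: eq_bigr => i _ /=.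
  by rewrite hornerD hornerC hornerZ hornerN hornerX mulrN1.
have hB : B.[1] = q ^+ (n * n) * qpoch n.
  have -> : q ^+ (n * n) = \prod_(i < n) q ^+ n by rewrite prodr_const card_ord exprM.
  rewrite -big_split horner_prod.
  apply: eq_bigr => i _ /=.
  by rewrite hornerD hornerC hornerZ hornerN hornerX /bump add1n exprD; ring.
rewrite !derivM !(hornerD, hornerM) hA hB derivD derivC derivZ derivN derivX.
rewrite add0r !(hornerC, hornerZ, hornerN, hornerX) !exprD; ring.
Qed.

(** A finite form of Jacobi's formula: the terms k = n - j and k = n + 1 + j of the
    previous sum carry the same power of q and opposite signs, so they are paired. *)
Lemma finite_jacobi n (N := (n + n.+1)%N) :
  \sum_(j < n.+1) (-1) ^+ j * q ^+ 'C(j.+1, 2) *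
     ((n + j.+1)%:R * qbinom N (n + j.+1) - (n - j)%:R * qbinom N (n - j))
  = qpoch n ^+ 2.
Proof.
have bin2D a b : 'C(a + b, 2) = ('C(a, 2) + 'C(b, 2) + a * b)%N.
  by elim: b => [|b IH]; rewrite ?addnS ?binS2 ?IH ?addn0 ?muln0 ?addn0 //; lia.
(* The smallest exponent of q on the left-hand side of the previous lemma. *)
pose c := (n + 'C(n, 2) + n * n)%N.
apply: (@q_reg c).
have cancel_sign (f g : series) : - (-1) ^+ n * f = - (-1) ^+ n * g -> f = g.
  move/(congr1 (fun f => - (-1) ^+ n * f)); rewrite !mulrA mulrNN -expr2 sqrr_sign.
  by rewrite !mul1r.
apply: cancel_sign; rewrite [RHS]mulrA -q_binomial_derivative -/N.
rewrite -[N.+1]/(n.+1 + n.+1)%N big_split_ord /=.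
rewrite [X in X + _](reindex_inj rev_ord_inj) /= -big_split !mulr_sumr.
apply: eq_bigr => -[j /= ltj] _; rewrite subSS.
have {ltj} [a nE] : exists a, n = (a + j)%N by exists (n - j)%N; rewrite subnK.
have sqr_bin m : (m * m = 2 * 'C(m, 2) + m)%N.
  by elim: m => // m IH; rewrite binS2; lia.
have e1 : ('C(n - j, 2) + n * (N - (n - j)) = c + 'C(j.+1, 2))%N.
  rewrite /c /N nE addnK (_ : a + j + (a + j).+1 - a = a + 2 * j + 1)%N; last by lia.
  by rewrite binS2 bin2D; have := sqr_bin j; lia.
have e2 : ('C(n.+1 + j, 2) + n * (N - (n.+1 + j)) = c + 'C(j.+1, 2))%N.
  rewrite /c /N nE (_ : a + j + (a + j).+1 - ((a + j).+1 + j) = a)%N; last by lia.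
  by rewrite addSn !binS2 !bin2D; have := sqr_bin j; lia.
rewrite e1 e2 addSn addnS exprD.
have -> : (-1) ^+ (n - j) = (-1) ^+ n * (-1) ^+ j :> series.
  by rewrite nE addnK exprD -mulrA -expr2 sqrr_sign mulr1.
rewrite exprS exprD; ring.
Qed.

Definition jacobi_sum K : series :=
  \sum_(j < K) (-1) ^+ j * (2 * j + 1)%:R * q ^+ 'C(j.+1, 2).

Definition eulerV := sinv euler.

Lemma euler_mulV : euler * eulerV = 1.
Proof. exact: mul_sinv coef_euler0. Qed.

(** The q-binomial coefficient tends to 1/E_1 when both lower parameters grow. *)
Lemma eqmodq_qbinom m a b : (m <= a)%N -> (m <= b)%N ->
  euler * qbinom (a + b) a =_[m] 1.
Proof.
move=> ma mb.
have h k : (m <= k)%N -> euler =_[m] qpoch k by move=> mk; apply/esym/eqmodq_qpoch.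
apply: (eqmodq_trans (g := eulerV * (qbinom (a + b) a * qpoch a * qpoch b))).
  have -> : euler * qbinom (a + b) a = eulerV * (qbinom (a + b) a * euler * euler).
    by rewrite -[LHS]mul1r -euler_mulV; ring.
  by apply: eqmodqM => //; apply: eqmodqM (h _ mb); apply: eqmodqM (h _ ma).
rewrite qbinom_qpoch -euler_mulV mulrC; apply: eqmodqM => //.
by apply/eqmodq_qpoch; lia.
Qed.

(** The limit of the finite form, in which the weights n + 1 + j and n - j combine to
    2j + 1. *)
Lemma jacobi_cube m K : (m < K)%N -> euler ^+ 3 =_[m] jacobi_sum K.
Proof.
move=> mK; pose n := (m + K)%N.
have trunc_sum L : (m < L)%N -> jacobi_sum L =_[m] jacobi_sum m.+1.
  elim: L => // L IH; rewrite ltnS leq_eqVlt => /orP[/eqP -> // | mL].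
  rewrite /jacobi_sum big_ord_recr -[X in _ =_[_] X]addr0; apply: eqmodqD (IH mL) _.
  by rewrite mulrC; apply: eqmodq_qXn; rewrite /= binS2; lia.
apply: (eqmodq_trans (g := jacobi_sum n.+1)); last first.
  apply: eqmodq_trans (trunc_sum _ _) (esym (trunc_sum _ mK)); rewrite /n; lia.
have h k : (m <= k)%N -> euler =_[m] qpoch k by move=> mk; apply/esym/eqmodq_qpoch.
apply: (eqmodq_trans (g := euler * qpoch n ^+ 2)).
  by rewrite exprS; apply: eqmodqM => //; apply: eqmodqX; apply: h; rewrite /n; lia.
rewrite -finite_jacobi mulr_sumr; apply: eqmodq_sum => -[j /= ltj] _.
set b1 := qbinom _ _; set b2 := qbinom _ _.
have -> : euler * ((-1) ^+ j * q ^+ 'C(j.+1, 2)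
                     * ((n + j.+1)%:R * b1 - (n - j)%:R * b2))
   = (-1) ^+ j * q ^+ 'C(j.+1, 2)
       * ((n + j.+1)%:R * (euler * b1) + - (n - j)%:R * (euler * b2)).
  by ring.
rewrite [_ * (2 * j + 1)%:R * _]mulrAC; case: (leqP m.+1 j) => hj.
  have small f : (-1) ^+ j * q ^+ 'C(j.+1, 2) * f =_[m] 0.
    by rewrite mulrAC mulrC; apply: eqmodq_qXn; rewrite binS2; lia.
  exact: eqmodq_trans (small _) (esym (small _)).
apply: eqmodqM => //.
have -> : (2 * j + 1)%:R = (n + j.+1)%:R * 1 + - (n - j)%:R * 1 :> series.
  by rewrite !mulr1 -natrB; [congr (_%:R) | ]; lia.
apply: eqmodqD; apply: eqmodqM => //; rewrite /b1 /b2.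
  rewrite (_ : n + n.+1 = (n + j.+1) + (n - j))%N; last by rewrite /n; lia.
  by apply: eqmodq_qbinom; rewrite /n; lia.
rewrite (_ : n + n.+1 = (n - j) + (n + j.+1))%N; last by rewrite /n; lia.
by apply: eqmodq_qbinom; rewrite /n; lia.
Qed.

Lemma sum_ord3 (F : nat -> series) m :
  \sum_(i < 3 * m) F i
  = \sum_(i < m) F (3 * i)%N + \sum_(i < m) F (3 * i).+1 + \sum_(i < m) F (3 * i).+2.
Proof.
elim: m => [|m IH]; first by rewrite !big_ord0 !addr0.
by rewrite mulnS addnC addn3 !big_ord_recr /= IH; ring.
Qed.

(** The exponent j(j+1)/2 is divisible by 3 unless j = 3i+1, when it equals
    1 + 9 i(i+1)/2; the corresponding terms of Jacobi's series reassemble it in q^9,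
    with the factor -3. *)
Lemma euler3_dissection :
  sec 1 (euler ^+ 3) = - 3%:R * dil euler ^+ 3 /\ sec 2 (euler ^+ 3) = 0.
Proof.
pose term (j c : nat) : series := (-1) ^+ j * (2 * j + 1)%:R * q ^+ c.
have dil_term (j c : nat) : dil (term j c) = term j (3 * c)%N.
  by rewrite /term !rmorphM !rmorphXn /= rmorph_nat rmorphN1 dil_q exprM.
have bin3 i : ('C((3 * i).+1, 2) = 3 * (3 * 'C(i, 2) + 2 * i))%N.
  elim: i => // i IH; rewrite (_ : (3 * i.+1).+1 = (3 * i).+1.+3)%N; last by lia.
  by move: IH; rewrite !binS2; lia.
have key m : exists a,
    euler ^+ 3
    =_[3 * m + 2] dil a + q * dil (- 3%:R * dil (jacobi_sum m.+1)) + q ^+ 2 * dil 0.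
  exists (\sum_(i < m.+1) term (3 * i)%N (3 * 'C(i, 2) + 2 * i)%N
        + \sum_(i < m.+1) term (3 * i).+2 (3 * 'C(i, 2) + 4 * i + 1)%N).
  have lt3 : (3 * m + 2 < 3 * m.+1)%N by lia.
  apply: eqmodq_trans (jacobi_cube lt3) _; congr (trunc _ _).
  rewrite /jacobi_sum (sum_ord3 (fun j => term j 'C(j.+1, 2))).
  rewrite !(rmorphD, rmorphM, rmorph_sum, rmorph0, rmorph1, rmorphN) /=.
  rewrite mulr0 addr0 [RHS]addrAC; congr (_ + _ + _).
  - by apply: eq_bigr => i _; rewrite dil_term bin3.
  - rewrite !mulr_sumr; apply: eq_bigr => i _.
    have -> : 'C((3 * i).+2, 2) = (3 * (3 * 'C(i.+1, 2))).+1.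
      by rewrite [LHS]binS2 bin3 binS2; lia.
    rewrite -!/(term _ _) !dil_term /term [q ^+ _.+1]exprS.
    have -> : (-1) ^+ (3 * i).+1 = - (-1) ^+ i :> series.
      by rewrite exprS exprM (_ : (-1) ^+ 3 = -1) ?mulN1r //; ring.
    have -> : (2 * (3 * i).+1 + 1)%:R = 3%:R * (2 * i + 1)%:R :> series.
      by rewrite -natrM; congr (_%:R); lia.
    ring.
  by apply: eq_bigr => i _; rewrite dil_term 2!binS2 bin3; congr (term _ _); lia.
have key' m : sec 1 (euler ^+ 3) =_[m] - 3%:R * dil euler ^+ 3
           /\ sec 2 (euler ^+ 3) =_[m] 0.
  have [a h] := key m.
  have [_ u1 u2] := sec_dissection a (- 3%:R * dil (jacobi_sum m.+1)) 0.
  split.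
    apply: eqmodq_trans (eqmodq_sec _ h) _ => //; rewrite u1; apply: eqmodqM => //.
    by rewrite -rmorphXn; apply/eqmodq_dil/esym/jacobi_cube.
  by apply: eqmodq_trans (eqmodq_sec _ h) _ => //; rewrite u2.
by split; apply: eqmodq_eq => m; case: (key' m).
Qed.

(** * Polynomials in two cube roots, graded modulo 3 *)

(** The ring Z[t]. *)
Inductive Zgen (t : series) : series -> Prop :=
| Zgen1 : Zgen t 1
| Zgen_self : Zgen t t
| ZgenB f g : Zgen t f -> Zgen t g -> Zgen t (f - g)
| ZgenM f g : Zgen t f -> Zgen t g -> Zgen t (f * g).

Lemma Zgen0 t : Zgen t 0.
Proof. by rewrite -(subrr 1); apply: ZgenB; apply: Zgen1. Qed.

Lemma ZgenD t f g : Zgen t f -> Zgen t g -> Zgen t (f + g).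
Proof.
move=> hf hg; rewrite -[g]opprK -[- g]add0r; apply: ZgenB => //.
by apply: ZgenB => //; apply: Zgen0.
Qed.

Lemma Zgen_nat t n : Zgen t n%:R.
Proof.
elim: n => [|n IH]; first exact: Zgen0.
by rewrite -natr1; apply: ZgenD => //; apply: Zgen1.
Qed.

#[local] Hint Resolve Zgen0 Zgen1 Zgen_self Zgen_nat ZgenB ZgenD ZgenM : core.

Section Graded.
Variables t u g : series.
Hypotheses (u_cube : u ^+ 3 = dil t) (g_cube : g ^+ 3 = 1 + dil t).

(** In the application, u is q times a series in q^3 and g is a series in q^3.  The
    monomials listed for each degree span that degree modulo 3, because u^3 and g^3 are
    scalars. *)
Definition graded e0 e1 e2 (f : series) := exists a b c,
  [/\ Zgen t a, Zgen t b, Zgen t c & f = e0 * dil a + e1 * dil b + e2 * dil c].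
Definition grade0 := graded 1 (u * g ^+ 2) (u ^+ 2 * g).
Definition grade1 := graded g u (u ^+ 2 * g ^+ 2).
Definition grade2 := graded (g ^+ 2) (u * g) (u ^+ 2).

Ltac graded_solve :=
  move=> [a [b [c [ha hb hc ->]]]] [a' [b' [c' [ha' hb' hc' ->]]]].

Ltac graded_ring :=
  rewrite !(rmorphD, rmorphM, rmorph1) /= -u_cube;
  have -> : 1 + u ^+ 3 = g ^+ 3 by [rewrite g_cube u_cube];
  ring.

(** In these products every monomial is brought back to the chosen basis by
    u^3 = t(q^3) and g^3 = 1 + t(q^3), which gives the coefficients exhibited. *)
Lemma grade00 f h : grade0 f -> grade0 h -> grade0 (f * h).
Proof.
graded_solve.
exists (a * a' + t * (1 + t) * (b * c' + c * b')),
       (a * b' + b * a' + t * c * c'),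
       (a * c' + c * a' + (1 + t) * b * b'); split; auto 10.
graded_ring.
Qed.

Lemma grade20 f h : grade2 f -> grade0 h -> grade2 (f * h).
Proof.
graded_solve.
exists (a * a' + t * (b * c' + c * b')),
       (a * (1 + t) * b' + b * a' + t * c * c'),
       (a * (1 + t) * c' + c * a' + (1 + t) * b * b'); split; auto 10.
graded_ring.
Qed.

Lemma grade10 f h : grade1 f -> grade0 h -> grade1 (f * h).
Proof.
graded_solve.
exists (a * a' + t * (b * c') + t * (1 + t) * c * b'),
       ((1 + t) * a * b' + b * a' + t * (1 + t) * c * c'),
       (a * c' + c * a' + b * b'); split; auto 10.
graded_ring.
Qed.

Lemma grade22 f h : grade2 f -> grade2 h -> grade1 (f * h).
Proof.
graded_solve.
exists ((1 + t) * a * a' + t * (b * c' + c * b')),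
       ((1 + t) * (a * b' + b * a') + t * c * c'),
       (a * c' + c * a' + b * b'); split; auto 10.
graded_ring.
Qed.

Lemma grade12 f h : grade1 f -> grade2 h -> grade0 (f * h).
Proof.
graded_solve.
exists ((1 + t) * a * a' + t * b * c' + t * (1 + t) * c * b'),
       ((a * b' + b * a') + t * c * c'),
       (a * c' + b * b' + (1 + t) * c * a'); split; auto 10.
graded_ring.
Qed.

Definition trinom := g ^+ 2 + u * g + u ^+ 2.

Lemma grade2_trinom : grade2 trinom.
Proof. by exists 1, 1, 1; split; auto; rewrite /trinom rmorph1 !mulr1. Qed.

Lemma grade1_trinom2 : grade1 (trinom ^+ 2).
Proof. exact: grade22 grade2_trinom grade2_trinom. Qed.

Lemma grade0_trinom3 : grade0 (trinom ^+ 3).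
Proof. by rewrite exprSr; apply: grade12 grade1_trinom2 grade2_trinom. Qed.

Lemma grade0_u_trinom k : grade0 (k%:R * u * trinom).
Proof.
exists (k%:R * t), k%:R, k%:R.
split; [apply: ZgenM (Zgen_self _) | | |]; try exact: Zgen_nat.
by rewrite rmorphM !(rmorph_nat dil) /= -u_cube /trinom; ring.
Qed.

(** A series t(q) must be rewritten over t(q^3) before it can be dissected.  When t is
    of the form below it has degree 1 + 2 * 4, that is 0 modulo 3. *)
Lemma Zgen_grade0 k f : t = k%:R * u * trinom * trinom ^+ 3 -> Zgen t f -> grade0 f.
Proof.
move=> tE; elim=> {f} [||f h _ hf _ hh|f h _ hf _ hh].
- by exists 1, 0, 0; split; auto; rewrite rmorph1 rmorph0; ring.
- by rewrite [X in grade0 X]tE; apply: grade00 (grade0_u_trinom k) grade0_trinom3.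
- move: hf hh; graded_solve; exists (a - a'), (b - b'), (c - c'); split; auto.
  by rewrite !rmorphB /=; ring.
exact: grade00.
Qed.

End Graded.

(** * The 3-dissection of rho^3 *)

Definition rho := dil euler * eulerV.
Definition rho_inv := euler * dil eulerV.
(** The series P of the 3-dissection of E_1^3, scaled to be a cube root of 1 + tau. *)
Definition cbrt := sec 0 (euler ^+ 3) * dil euler * eulerV ^+ 4.
Definition tau := 27%:R * q * rho ^+ 12.
Definition w := 3%:R * q * dil rho ^+ 4.
Definition dil_cbrt := dil cbrt.

Lemma dil_euler_mulV : dil euler * dil eulerV = 1.
Proof. by rewrite -rmorphM euler_mulV rmorph1. Qed.

Lemma rho_mulV : rho * rho_inv = 1.
Proof.
rewrite /rho /rho_inv.
transitivity ((euler * eulerV) * (dil euler * dil eulerV)); first by ring.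
by rewrite euler_mulV dil_euler_mulV mulr1.
Qed.

(** The norm of E_1^3 computed in two ways: from its sections, which gives
    P^3 - 27 q E_3^9, and by multiplicativity. *)
Lemma cbrt_cube : cbrt ^+ 3 = 1 + tau.
Proof.
set P := sec 0 (euler ^+ 3).
have h : (P ^+ 3 - 27%:R * q * dil euler ^+ 9) * dil euler ^+ 3 = euler ^+ 12.
  rewrite (_ : euler ^+ 12 = (euler ^+ 4) ^+ 3); last by ring.
  rewrite -norm3_euler exprMn; congr (_ * _).
  by rewrite -norm3X /norm3 -/P; have [-> ->] := euler3_dissection; ring.
have -> : cbrt ^+ 3
    = (P ^+ 3 - 27%:R * q * dil euler ^+ 9) * dil euler ^+ 3 * eulerV ^+ 12 + tau.
  by rewrite /cbrt -/P /tau /rho; ring.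
by rewrite h -exprMn euler_mulV expr1n.
Qed.

Lemma w_cube : w ^+ 3 = dil tau.
Proof. by rewrite /w /tau !(rmorphM, rmorphXn, rmorph_nat) /= dil_q; ring. Qed.

Lemma dil_cbrt_cube : dil_cbrt ^+ 3 = 1 + dil tau.
Proof. by rewrite /dil_cbrt -rmorphXn cbrt_cube rmorphD rmorph1. Qed.

(** After scaling, the dissection of E_1^3 reads rho^3 (g - w) = rho(q^3), and
    g^3 - w^3 = 1 makes g^2 + w g + w^2 the inverse of g - w. *)
Lemma rho_cube : rho ^+ 3 = dil rho * trinom w dil_cbrt.
Proof.
have h : rho ^+ 3 * (dil_cbrt - w) = dil rho.
  have e : euler ^+ 3 = dil (sec 0 (euler ^+ 3)) - 3%:R * q * dil (dil euler) ^+ 3.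
    rewrite {1}(dissection (euler ^+ 3)); have [-> ->] := euler3_dissection.
    by rewrite !(rmorph0, rmorphM, rmorphN, rmorphXn, rmorph_nat) /=; ring.
  have -> : dil_cbrt - w = dil (dil euler) * dil eulerV ^+ 4 * euler ^+ 3.
    by rewrite e /dil_cbrt /w /cbrt /rho !(rmorphM, rmorphXn) /=; ring.
  have -> : rho ^+ 3 * (dil (dil euler) * dil eulerV ^+ 4 * euler ^+ 3)
      = (dil euler * dil eulerV) ^+ 3 * (euler * eulerV) ^+ 3
        * (dil (dil euler) * dil eulerV) by rewrite /rho; ring.
  by rewrite dil_euler_mulV euler_mulV !expr1n !mul1r /rho rmorphM.
have -> : rho ^+ 3 = rho ^+ 3 * (dil_cbrt - w) * trinom w dil_cbrt
                   + rho ^+ 3 * (1 + w ^+ 3 - dil_cbrt ^+ 3).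
  by rewrite /trinom; ring.
by rewrite h w_cube dil_cbrt_cube subrr mulr0 addr0.
Qed.

Lemma tauE : tau = 9%:R * w * trinom w dil_cbrt * trinom w dil_cbrt ^+ 3.
Proof.
have -> : tau = 27%:R * q * (rho ^+ 3) ^+ 4 by rewrite /tau -exprM.
by rewrite rho_cube /w; ring.
Qed.

(** The next three lemmas take the section whose index is the degree: only the monomial
    w^r g^0 of the basis contributes, and w^r = 3^r q^r rho(q^3)^(4r). *)
Lemma sec_grade0 x f : grade0 tau w dil_cbrt f ->
  exists2 b, Zgen tau b & sec 0 (dil x * f) = x * b.
Proof.
move=> [a [b [c [ha hb hc ->]]]]; exists a => //.
have [<- _ _] := sec_dissection (x * a) (x * 3%:R * rho ^+ 4 * cbrt ^+ 2 * b)
   (x * 9%:R * rho ^+ 8 * cbrt * c).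
by congr (sec 0 _); rewrite /w /dil_cbrt !(rmorphM, rmorphXn, rmorph_nat) /=; ring.
Qed.

Lemma sec_grade1 x f : grade1 tau w dil_cbrt f ->
  exists2 b, Zgen tau b & sec 1 (dil x * f) = 3%:R * x * rho ^+ 4 * b.
Proof.
move=> [a [b [c [ha hb hc ->]]]]; exists b => //.
have [_ <- _] := sec_dissection (x * cbrt * a) (3%:R * x * rho ^+ 4 * b)
   (x * 9%:R * rho ^+ 8 * cbrt ^+ 2 * c).
by congr (sec 1 _); rewrite /w /dil_cbrt !(rmorphM, rmorphXn, rmorph_nat) /=; ring.
Qed.

Lemma sec_grade2 x f : grade2 tau w dil_cbrt f ->
  exists2 b, Zgen tau b & sec 2 (dil x * f) = 9%:R * x * rho ^+ 8 * b.
Proof.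
move=> [a [b [c [ha hb hc ->]]]]; exists c => //.
have [_ _ <-] := sec_dissection (x * cbrt ^+ 2 * a) (3%:R * x * rho ^+ 4 * cbrt * b)
   (9%:R * x * rho ^+ 8 * c).
by congr (sec 2 _); rewrite /w /dil_cbrt !(rmorphM, rmorphXn, rmorph_nat) /=; ring.
Qed.

(** Modulo 3, rho^3, rho^6 and rho^9 have degrees 2, 1 and 0. *)
Lemma sec2_step x a : Zgen tau a ->
  exists2 b, Zgen tau b & sec 2 (dil x * (rho ^+ 3 * a)) = 9%:R * x * rho ^+ 9 * b.
Proof.
move=> /(Zgen_grade0 w_cube dil_cbrt_cube tauE) ha.
have [b hb e] := sec_grade2 (x * rho)
  (grade20 w_cube dil_cbrt_cube (grade2_trinom _ _ _) ha).
exists b; first exact: hb.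
transitivity (9%:R * (x * rho) * rho ^+ 8 * b); last by ring.
by rewrite -e rho_cube; congr (sec 2 _); rewrite [dil (x * rho)]rmorphM; ring.
Qed.

Lemma sec1_step x a : Zgen tau a ->
  exists2 b, Zgen tau b & sec 1 (dil x * (rho ^+ 6 * a)) = 3%:R * x * rho ^+ 6 * b.
Proof.
move=> /(Zgen_grade0 w_cube dil_cbrt_cube tauE) ha.
have [b hb e] := sec_grade1 (x * rho ^+ 2)
  (grade10 w_cube dil_cbrt_cube (grade1_trinom2 w_cube dil_cbrt_cube) ha).
exists b; first exact: hb.
transitivity (3%:R * (x * rho ^+ 2) * rho ^+ 4 * b); last by ring.
rewrite -e; congr (sec 1 _); rewrite (_ : rho ^+ 6 = (rho ^+ 3) ^+ 2); last by ring.
rewrite rho_cube.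
by rewrite !(rmorphM, rmorphXn) /=; ring.
Qed.

Lemma sec0_step x a : Zgen tau a ->
  exists2 b, Zgen tau b & sec 0 (dil x * (rho ^+ 9 * a)) = x * rho ^+ 3 * b.
Proof.
move=> /(Zgen_grade0 w_cube dil_cbrt_cube tauE) ha.
have [b hb e] := sec_grade0 (x * rho ^+ 3)
  (grade00 w_cube dil_cbrt_cube (grade0_trinom3 w_cube dil_cbrt_cube) ha).
exists b; first exact: hb.
rewrite -e rmorphM rmorphXn /=; congr (sec 0 _).
rewrite (_ : rho ^+ 9 = (rho ^+ 3) ^+ 3); last by ring.
by rewrite rho_cube; ring.
Qed.

Lemma coef_sec r f n : coef (sec r f) n = coef f (3 * n + r).
Proof. by []. Qed.

Lemma dil_natM n f : dil (n%:R * f) = n%:R * dil f.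
Proof. by rewrite rmorphM rmorph_nat. Qed.

(** * Iterating along the arithmetic progressions *)

Definition RDseries := (rho * dil (dil (dil rho_inv))) ^+ 3.

(** The nested sections select the coefficients of index 3 (3 (3n + 2)) + 2 = 27n + 20. *)
Lemma sec_RDseries : exists2 b, Zgen tau b &
  sec 2 (sec 0 (sec 2 RDseries)) = 81%:R * rho ^+ 6 * b.
Proof.
have [b0 h0 e0] := sec2_step (dil (dil (rho_inv ^+ 3))) (Zgen1 tau).
have [b1 h1 e1] := sec0_step (9%:R * dil (rho_inv ^+ 3)) h0.
have [b2 h2 e2] := sec2_step (9%:R * rho_inv ^+ 3) h1.
exists b2 => //.
have -> : sec 2 RDseries = dil (9%:R * dil (rho_inv ^+ 3)) * (rho ^+ 9 * b0).
  rewrite (_ : RDseries = dil (dil (dil (rho_inv ^+ 3))) * (rho ^+ 3 * 1)) ?e0.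
    by rewrite dil_natM; ring.
  by rewrite /RDseries !rmorphXn /=; ring.
rewrite e1 (_ : _ * _ * b1 = dil (9%:R * rho_inv ^+ 3) * (rho ^+ 3 * b1)); last first.
  by rewrite dil_natM; ring.
rewrite e2 (_ : _ * b2 = 81%:R * rho ^+ 6 * b2 * (rho * rho_inv) ^+ 3); last by ring.
by rewrite rho_mulV expr1n mulr1.
Qed.

(** Replacing n by 3n + 1 takes the progression for k to the one for k + 1. *)
Lemma coef_RDseries_progression k : (3 <= k)%N -> exists2 b, Zgen tau b & forall n,
  coef RDseries (3 ^ k * n + (3 ^ k + 13) %/ 2)
  = coef ((3 ^ k.+1)%:R * (rho ^+ 6 * b)) n.
Proof.
elim: k => // k IH; rewrite ltnS leq_eqVlt => /orP[/eqP <- | /IH [b hb e]].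
  have [b hb e] := sec_RDseries; exists b => [//|n].
  have -> : (3 ^ 4 = 81)%N by [].
  rewrite mulrA -e !coef_sec; congr (coef RDseries _); lia.
have [c hc e'] := sec1_step (3 ^ k.+1)%:R hb.
exists c => // n.
rewrite (_ : coef _ n = coef (sec 1 ((3 ^ k.+1)%:R * (rho ^+ 6 * b))) n).
  rewrite [RHS]coef_sec -e; congr (coef RDseries _); rewrite expnS.
  by move: (3 ^ k)%N => x; lia.
rewrite -[in RHS](rmorph_nat dil) e' (expnS 3 k.+1) natrM.
by congr (coef _ n); ring.
Qed.

Lemma dvd_coef_RDseries k n : (3 <= k)%N ->
  ((3 ^ k.+1)%:Z %| coef RDseries (3 ^ k * n + (3 ^ k + 13) %/ 2)%N)%Z.
Proof.
move=> /coef_RDseries_progression [b _ ->].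
by rewrite mulr_natl coefMn -mulr_natr; apply: dvdz_mull; rewrite natz.
Qed.

(** * The generating series of the partition function *)

(** The contribution of the part i + 1 in one colour, with multiplicities at most n. *)
Definition part_factor l t n i : series :=
  \sum_(j < n.+1 | (j < t)%N && ((0 < j)%N ==> ~~ (l %| i.+1)%N)) q ^+ (j * i.+1).

(** Expanding the product, each choice of one exponent per coloured part is a
    multiplicity function. *)
Lemma RD_generating k l t n :
  (RD k l t n)%:R = coef (\prod_(i < n) part_factor l t n i ^+ k) n.
Proof.
have -> : \prod_(i < n) part_factor l t n i ^+ k
    = \prod_(x : 'I_n * 'I_k) part_factor l t n x.1.
  rewrite -(pair_bigA _ (fun (i : 'I_n) (_ : 'I_k) => part_factor l t n i)) /=.
  by apply: eq_bigr => i _; rewrite prodr_const card_ord.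
rewrite /part_factor bigA_distr_big_dep coef_sum.
under eq_bigr => m _.
  rewrite -expr_sum coef_qXn eq_sym mulrb.
  over.
rewrite -big_mkcondr sumr_const; congr (_%:R).
rewrite /RD cardsE; apply: eq_card => m.
rewrite [LHS]unfold_in in_set [RHS]unfold_in /= andbC.
congr (_ && _); apply/andP/forallP => [[/forallP h1 /forallP h2] x | h].
  by rewrite unfold_in h1 h2.
by split; apply/forallP => x; have := h x; rewrite unfold_in => /andP[].
Qed.

Definition part_gf i : series :=
  if (3 %| i.+1)%N then 1 else \sum_(j < 27) q ^+ (j * i.+1).

Lemma eqmodq_part_factor n i : part_factor 3 27 n i =_[n] part_gf i.
Proof.
rewrite /part_factor /part_gf; case: ifP => _ /=.
  rewrite (big_pred1 ord0) ?mul0n // => j.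
  by rewrite /= -val_eqE /=; case: (val j) => [|m]; rewrite ?andbF.
under eq_bigl => j do rewrite implybT andbT.
(* The two ranges, j <= n and j < 27, are compared inside a common larger one; terms
   with j > n vanish to the given precision. *)
rewrite (big_ord_widen_cond (n.+1 + 27) (fun j => (j < 27)%N)
          (fun j => q ^+ (j * i.+1))).
  rewrite (big_ord_widen (n.+1 + 27) (fun j => q ^+ (j * i.+1))); last by lia.
  rewrite [X in X =_[_] _]big_mkcond [X in _ =_[_] X]big_mkcond.
  apply: eqmodq_sum => j _; case: (j < 27)%N => //=; case: ifP => // jn.
  by apply/esym; rewrite -[q ^+ _]mulr1; apply: eqmodq_qXn; nia.
by lia.
Qed.

Lemma eqmodq_part_gf1 i : part_gf i =_[i] 1.
Proof.
rewrite /part_gf; case: ifP => // _.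
rewrite big_ord_recl -[X in _ =_[_] X]addr0; apply: eqmodqD => //.
elim/big_rec: _ => // j x _ hx; rewrite -[X in _ =_[_] X]addr0; apply: eqmodqD hx.
by rewrite -[q ^+ _]mulr1; apply: eqmodq_qXn; rewrite /= /bump; nia.
Qed.

(** A truncated form of the product E_3 E_27 / (E_1 E_81), with the denominators
    cleared. *)
Lemma part_gf_qpoch m :
  \prod_(i < 3 * m) part_gf i * qpoch (3 * m) * dil (dil (dil (dil (qpoch m))))
  = dil (dil (dil (qpoch (3 * m)))) * dil (qpoch m).
Proof.
have dil_factor k : dil (1 - q ^+ k) = 1 - q ^+ (3 * k).
  by rewrite rmorphB rmorph1 rmorphXn /= dil_q exprM.
have dil3_qpoch n : dil (dil (dil (qpoch n))) = \prod_(i < n) (1 - q ^+ (27 * i.+1)).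
  by rewrite 3!rmorph_prod; apply: eq_bigr => i _ /=; rewrite !dil_factor !mulnA.
have part_gf_telescope i : ~~ (3 %| i.+1)%N ->
    part_gf i * (1 - q ^+ i.+1) = 1 - q ^+ (27 * i.+1).
  move=> /negbTE h; rewrite /part_gf h.
  rewrite -[RHS]opprB mulnC exprM subrX1 -mulNr opprB mulrC.
  by congr (_ * _); apply: eq_bigr => j _; rewrite -exprM mulnC.
rewrite (_ : dil (dil (dil (dil (qpoch m))))
           = \prod_(i < m) (1 - q ^+ (27 * (3 * i).+3))).
  rewrite dil3_qpoch.
  rewrite dil_qpoch /qpoch !(prod_ord3 part_gf).
  rewrite !(prod_ord3 (fun i => 1 - q ^+ (27 * i.+1))).
  rewrite (prod_ord3 (fun i => 1 - q ^+ i.+1)) -!big_split.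
  apply: eq_bigr => i _ /=.
  rewrite -(part_gf_telescope (3 * i)%N) -?(part_gf_telescope (3 * i).+1); try lia.
  have -> : part_gf (3 * i).+2 = 1 by rewrite /part_gf ifT //; lia.
  ring.
rewrite dil3_qpoch rmorph_prod; apply: eq_bigr => i _ /=.
by rewrite dil_factor; congr (_ - q ^+ _); lia.
Qed.

Lemma coef_RDseries n : coef RDseries n = (RD 3 3 27 n)%:R.
Proof.
have part_gf_prod d : \prod_(i < n + d) part_gf i =_[n] \prod_(i < n) part_gf i.
  elim: d => [|d IH]; first by rewrite addn0.
  rewrite addnS big_ord_recr -[X in _ =_[_] X]mulr1; apply: eqmodqM => //.
  by apply: eqmodq_le (eqmodq_part_gf1 _); rewrite leq_addr.
have h k : (n <= k)%N -> euler =_[n] qpoch k by move=> nk; apply/esym/eqmodq_qpoch.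
have part_gf_RD : \prod_(i < 3 * n) part_gf i =_[n] rho * dil (dil (dil rho_inv)).
  set P := \prod_(i < _) _; pose inv4 := dil (dil (dil (dil eulerV))).
  have mul4 : dil (dil (dil (dil euler))) * inv4 = 1.
    by rewrite -!rmorphM euler_mulV !rmorph1.
  have -> : P = (P * euler * dil (dil (dil (dil euler)))) * eulerV * inv4.
    transitivity (P * (euler * eulerV) * (dil (dil (dil (dil euler))) * inv4)).
      by rewrite euler_mulV mul4 !mulr1.
    by ring.
  have -> : rho * dil (dil (dil rho_inv))
      = (dil (dil (dil euler)) * dil euler) * eulerV * inv4.
    by rewrite /rho /rho_inv !rmorphM /inv4; ring.
  do 2!apply: eqmodqM => //.
  apply: (eqmodq_trans (g := P * qpoch (3 * n) * dil (dil (dil (dil (qpoch n)))))).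
    by do !apply: eqmodqM => //; [apply: h; lia | do !apply: eqmodq_dil; apply: h].
  rewrite part_gf_qpoch; apply: esym.
  by apply: eqmodqM; do !apply: eqmodq_dil; apply: h; lia.
rewrite RD_generating.
have /eqmodqP : RDseries =_[n] \prod_(i < n) part_factor 3 27 n i ^+ 3.
  rewrite prodrXl /RDseries; apply: eqmodqX; apply: esym.
  have part_factor_gf :
      \prod_(i < n) part_factor 3 27 n i =_[n] \prod_(i < n) part_gf i.
    by apply: eqmodq_prod => i _; apply: eqmodq_part_factor.
  apply: etrans part_factor_gf _; apply: etrans (esym (part_gf_prod (2 * n)%N)) _.
  by rewrite -mulSn.
exact.
Qed.

Local Close Scope ring_scope.

Theorem corollary1p6 (k n : nat) (hk : 3 <= k) :
  RD 3 3 27 (3 ^ k * n + (3 ^ k + 13) %/ 2) = 0 %[mod 3 ^ k.+1].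
Proof.
have := dvd_coef_RDseries n hk; rewrite coef_RDseries natz dvdzE /= => /eqP ->.
by rewrite mod0n.
Qed.
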